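(* For all integers $n,k$ (with $k$ possibly depending on $n$) and every real $p\in[0,1]$, if $\mathbf{G}\sim\mathcal{G}(n,p,k)$, then asymptotically almost surely every randomized communication protocol solving the search problem $S_{\mathbf{G}}$ has cost $$\Omega\left(\min\left(\frac{1}{\sqrt{n^{0.05}(1-p)}},\ \frac{n^{0.225}}{\log(kn)}\right)\right).$$
   Context: Graphs are over $k$ blocks $V_1\sqcup\dots\sqcup V_k$, $|V_i|=n$, $n$ a power of $2$ with $\log n$ even; $\mathcal{G}(n,p,k)$: each pair of vertices in different blocks is an edge independently with probability $p$, no edges inside blocks. Let $\Sigma=\{0,1\}^{(\log n)/2}$ and identify each vertex of $V_i$ with a pair $(x_i,y_i)\in\Sigma\times\Sigma$ (the two halves of its binary representation). In the search problem $S_G$, Alice receives $x\in\Sigma^k$ and Bob receives $y\in\Sigma^k$; together they select the vertex $(x_i,y_i)$ in each block $V_i$, and they must output a pair of selected vertices (from different blocks) that are not adjacent in $G$. A randomized (public-coin) protocol is a distribution over deterministic two-party protocols that, on every input, outputs a correct answer with probability at least a fixed constant (e.g. $2/3$); its cost is the maximum number of bits communicated by a deterministic protocol in its support. ''Asymptotically almost surely'': with probability $1-o(1)$ as $n\to\infty$. *)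

(* Defs.v *)
From HB Require Import structures.
From mathcomp Require Import all_boot all_order all_algebra.
From mathcomp Require Import boolp reals exp.
Set Implicit Arguments. Unset Strict Implicit. Unset Printing Implicit Defensive.
Import Order.TTheory GRing.Theory Num.Theory.
Local Open Scope ring_scope.

Inductive proto (X Y O : Type) : Type :=
| PLeaf : O -> proto X Y O
| PAlice : (X -> bool) -> proto X Y O -> proto X Y O -> proto X Y O
| PBob : (Y -> bool) -> proto X Y O -> proto X Y O -> proto X Y O.

Fixpoint prun (X Y O : Type) (t : proto X Y O) (x : X) (y : Y) : O :=
  match t with
  | PLeaf o => o
  | PAlice f t0 t1 => if f x then prun t1 x y else prun t0 x y
  | PBob g t0 t1 => if g y then prun t1 x y else prun t0 x y
  end.

Fixpoint pcost (X Y O : Type) (t : proto X Y O) : nat :=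
  match t with
  | PLeaf _ => 0%N
  | PAlice _ t0 t1 => (maxn (pcost t0) (pcost t1)).+1
  | PBob _ t0 t1 => (maxn (pcost t0) (pcost t1)).+1
  end.

Definition rproto (R : realType) (X Y O : Type) := seq (R * proto X Y O).

Definition is_distr (R : realType) X Y O (P : rproto R X Y O) : Prop :=
  (forall w, w \in map fst P -> 0 <= w) /\ \sum_(w <- P) w.1 = 1.

Definition rcost (R : realType) X Y O (P : rproto R X Y O) : nat :=
  \max_(w <- P | 0 < w.1) pcost w.2.

Definition rsucc (R : realType) X Y O (ok : X -> Y -> O -> bool)
    (P : rproto R X Y O) (x : X) (y : Y) : R :=
  \sum_(w <- P | ok x y (prun w.2 x y)) w.1.

Definition rsolves (R : realType) X Y O (ok : X -> Y -> O -> bool)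
    (P : rproto R X Y O) : Prop :=
  is_distr P /\ forall x y, 2 / 3 <= rsucc ok P x y.

(* Sigma = {0,1}^m with m = (log n)/2, i.e. n = 2^(2m).  A vertex of block
   V_i is (i, (x_i, y_i)). *)
Definition Sigma (m : nat) := (m.-tuple bool)%type.
Definition Vtx (m k : nat) := ('I_k * (Sigma m * Sigma m))%type.

Definition cross_pairs (m k : nat) : {set {set Vtx m k}} :=
  [set e | [exists u : Vtx m k, exists v : Vtx m k,
             (u.1 != v.1) && (e == [set u; v])]].

(* a graph is an edge set E \subset cross_pairs m k *)
Definition adj (m k : nat) (E : {set {set Vtx m k}}) (u v : Vtx m k) : bool :=
  [set u; v] \in E.

Definition gnpk_prob (R : realType) (m k : nat) (p : R)
    (A : {set {set Vtx m k}} -> Prop) : R :=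
  \sum_(E in powerset (cross_pairs m k))
     (if `[< A E >] then p ^+ #|E| * (1 - p) ^+ #|cross_pairs m k :\: E|
      else 0).

Definition Inp (m k : nat) := {ffun 'I_k -> Sigma m}.

Definition sel (m k : nat) (x y : Inp m k) (i : 'I_k) : Vtx m k :=
  (i, (x i, y i)).

Definition S_ok (m k : nat) (E : {set {set Vtx m k}})
    (x y : Inp m k) (o : Vtx m k * Vtx m k) : bool :=
  [exists i : 'I_k, exists j : 'I_k,
     [&& i != j, o == (sel x y i, sel x y j) &
         ~~ adj E (sel x y i) (sel x y j)]].

(* min( 1/sqrt(n^0.05 (1-p)), n^0.225 / log(kn) ), where the first term is
   +infinity when p = 1. *)
Definition lbound (R : realType) (m k : nat) (p : R) : R :=
  let n : R := (2 ^ (2 * m))%:R in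
  let B := n `^ (9 / 40) / ln (k%:R * n) in
  if p < 1 then Num.min (1 / Num.sqrt (n `^ (1 / 20) * (1 - p))) B else B.

Arguments gnpk_prob {R} m k p A.

(* Main.v *)
(* By averaging over uniform inputs it suffices to bound the success probability
   of a deterministic protocol. Each leaf rectangle A x B is refined so that, on
   both sides, every set J of blocks that is not yet fixed is spread out: each
   value of x_J has conditional probability at most theta^|J|, theta = |Sigma|^-0.95.
   When Alice's half of some blocks becomes predictable it gets fixed, and Bob,
   who is still spread out, then reveals his half of these blocks. In a random
   graph every vertex v and every half a have at most tau = O(|Sigma|(1-p) + log kn)
   vertices (a,b) not adjacent to v, so a revealed pair is a non-edge with
   probability at most zeta = |Sigma| tau theta^2. Each fixed block lowers the
   entropy deficiency of the rectangle by a constant on average, whereas a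
   communicated bit raises it by at most 1; hence cost c reveals O(c) blocks, a
   non-edge appears with probability O(c^2 zeta), and c = Omega(zeta^(-1/2)). *)
Require Import Defs.
From HB Require Import structures.
From mathcomp Require Import all_boot all_order all_algebra.
From mathcomp Require Import boolp reals exp.
From mathcomp Require Import sequences ring lra.
Import Order.TTheory GRing.Theory Num.Theory.
Local Open Scope ring_scope.
Set Implicit Arguments.
Unset Strict Implicit.

(** This is [ln t <= t - 1] at [t = b / a], scaled by [a]; with [a = 0] allowed, empty pieces of a
    rectangle obey the same entropy estimates. *)
Lemma mul_ln_ratio_le (R : realType) (a b : R) :
  0 <= a -> 0 < b -> a * (ln b - ln a) <= b - a.
Proof.
move=> a0 b0; have [->|an0] := eqVneq a 0; first by rewrite mul0r; lra.
have {}a0 : 0 < a by rewrite lt_neqAle eq_sym an0.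
rewrite -ln_div ?posrE//.
have h : ln (b / a) <= b / a - 1.
  have {1}-> : b / a = 1 + (b / a - 1) by rewrite addrC subrK.
  by rewrite le_ln1Dx// ltrBrDr addNr divr_gt0.
apply: (le_trans (ler_wpM2l (ltW a0) h)).
by rewrite mulrBr mulr1 mulrCA divff ?gt_eqF// mulr1.
Qed.

(** * Deficiency of sets of inputs *)

Section Inputs.
Variables (R : realType) (k : nat) (Sg : finType) (s0 : Sg).
Local Notation inp := {ffun 'I_k -> Sg}.
Implicit Types (A B : {set inp}) (S T J : {set 'I_k}) (x y z : inp).
Implicit Types (th : R) (W : inp -> inp -> bool).

Definition agree J z x := [forall i in J, x i == z i].
Definition slice A J z := [set x in A | agree J z x].
Definition fixed S A := {in A &, forall x x', {in S, x =1 x'}}.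
Definition clean th S A := [forall J : {set 'I_k}, forall z : inp,
  (J \subset ~: S) ==> (J != set0) ==> (#|slice A J z|%:R <= th ^+ #|J| * #|A|%:R)].
(** The entropy, in nats, that a uniform element of [A] lacks compared with a uniform assignment of
    the blocks outside [S]. *)
Definition defic S A : R := #|~: S|%:R * ln #|Sg|%:R - ln #|A|%:R.
Definition mass W A B : R := \sum_(x in A) \sum_(y in B) (W x y)%:R.

Lemma agreeP J z x : reflect {in J, x =1 z} (agree J z x).
Proof. by apply: (iffP forall_inP) => h i iJ; apply/eqP/h. Qed.

Lemma cleanP th S A : reflect (forall J z, J \subset ~: S -> J != set0 ->
  #|slice A J z|%:R <= th ^+ #|J| * #|A|%:R) (clean th S A).
Proof.
apply: (iffP forallP) => [h J z sJ J0|h J].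
  by have /forallP/(_ z) := h J; rewrite sJ J0.
by apply/forallP => z; apply/implyP => sJ; apply/implyP => J0; apply: h.
Qed.

Lemma slice_sub A J z : slice A J z \subset A.
Proof. by apply/subsetP => x; rewrite inE => /andP[]. Qed.

Lemma fixed_sub S A B : A \subset B -> fixed S B -> fixed S A.
Proof. by move=> /subsetP sAB fB x x' /sAB xB /sAB x'B; apply: fB. Qed.

Lemma fixed_slice S J A z : fixed S A -> fixed (S :|: J) (slice A J z).
Proof.
move=> fA x x'; rewrite !inE => /andP[xA /agreeP xz] /andP[x'A /agreeP x'z] i.
by rewrite inE => /orP[iS|iJ]; [exact: fA | rewrite xz// x'z].
Qed.

(** Partial assignments to [J] are encoded as total functions with default [s0] off [J], which gives
    each slice a unique index in [cells J]. *)
Definition restr J x : inp := [ffun i => if i \in J then x i else s0].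
Definition cells J := pffun_on s0 (mem J) (mem Sg).

Lemma card_cells J : #|cells J| = (#|Sg| ^ #|J|)%N.
Proof. exact: card_pffun_on. Qed.

Lemma restr_cells J x : restr J x \in cells J.
Proof.
apply/pffun_onP; split => // ; apply/supportP => i iJ.
by rewrite ffunE (negPf iJ).
Qed.

Lemma restr_cell J x z : z \in cells J -> (restr J x == z) = agree J z x.
Proof.
move=> /pffun_onP[/supportP zJ _]; apply/eqP/agreeP => [<- i iJ|h].
  by rewrite ffunE iJ.
apply/ffunP => i; rewrite ffunE; case: ifP => [/h//|/negbT/zJ//].
Qed.

Lemma sum_slices (F : inp -> R) J A :
  \sum_(x in A) F x = \sum_(z in cells J) \sum_(x in slice A J z) F x.
Proof.
rewrite (partition_big (restr J) (mem (cells J))) => [|x _]; last exact: restr_cells.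
apply: eq_bigr => z zJ; apply: eq_bigl => x.
by rewrite restr_cell // !inE.
Qed.

Lemma card_set_slices J A :
  #|A|%:R = \sum_(z in cells J) #|slice A J z|%:R :> R.
Proof.
rewrite -sumr_const (sum_slices _ J).
by apply: eq_bigr => z _; rewrite sumr_const.
Qed.

Lemma fixed_card S A : fixed S A -> (#|A| <= #|Sg| ^ #|~: S|)%N.
Proof.
move=> fA; rewrite -card_cells.
have /card_in_imset <- : {in A &, injective (restr (~: S))}.
  move=> x x' xA x'A /ffunP e; apply/ffunP => i.
  have [iS|iS] := boolP (i \in S); first exact: (fA x x').
  by have := e i; rewrite !ffunE inE iS.
by apply/subset_leq_card/subsetP => _ /imsetP[x _ ->]; apply: restr_cells.
Qed.

Lemma Sg_gt0 : (0 < #|Sg|)%N.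
Proof. by apply/card_gt0P; exists s0. Qed.

Lemma defic_ge0 S A : fixed S A -> 0 <= defic S A.
Proof.
move=> fA; rewrite /defic subr_ge0.
have [->|A0] := eqVneq #|A| 0%N.
  by rewrite ln0// mulr_ge0// ln_ge0// ler1n Sg_gt0.
rewrite mulr_natl -lnXn ?ltr0n ?Sg_gt0// -natrX ler_ln ?posrE ?ltr0n ?lt0n//.
  by rewrite ler_nat fixed_card.
by rewrite expn_eq0 negb_and -lt0n Sg_gt0.
Qed.

Lemma card_setC_union S J : J \subset ~: S ->
  #|~: (S :|: J)|%:R = #|~: S|%:R - #|J|%:R :> R.
Proof.
move=> sJ; rewrite -(cardsID J (~: S)) (setIidPr sJ) natrD addrAC subrr add0r.
by rewrite setCU -setDE.
Qed.

(** * Change of deficiency when a set is split *)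

Lemma card_setDr (I : finType) (D E : {set I}) :
  E \subset D -> #|D|%:R = #|E|%:R + #|D :\: E|%:R :> R.
Proof. by move=> sE; rewrite -(cardsID E D) (setIidPr sE) natrD. Qed.

(** Comparing each part with [A] by [mul_ln_ratio_le] bounds the increase by
    [(#|A| - #|A1|) + #|A1|]. *)
Lemma defic_bit S A A1 : A1 \subset A ->
  #|A1|%:R * defic S A1 + #|A :\: A1|%:R * defic S (A :\: A1)
  <= #|A|%:R * defic S A + #|A|%:R.
Proof.
move=> sA; have e := card_setDr sA; rewrite /defic.
have [a0|a0] := eqVneq #|A| 0%N.
  have := subset_leq_card sA; have := subset_leq_card (subsetDl A A1).
  by rewrite a0 !leqn0 => /eqP -> /eqP ->; rewrite !mul0r addr0.
have a1 : 0 < #|A|%:R :> R by rewrite ltr0n lt0n.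
have := mul_ln_ratio_le (ler0n _ #|A1|) a1.
have := mul_ln_ratio_le (ler0n _ #|A :\: A1|) a1.
move: e; set u := #|~: S|%:R * _; set a := _%:R; set b := #|A1|%:R.
set c := #|_ :\: _|%:R; move=> e h0 h1.
have -> : a * (u - ln a) = (b + c) * (u - ln a) by rewrite -e.
nra.
Qed.

(** Fixing [J] lowers the reference entropy by [#|J| * ln #|Sg|], while a slice this heavy loses
    less than [- #|J| * ln th] of its own. The loss of the complement, at most the size of the
    slice, becomes the [- 1], since [#|J| >= 1]. *)
Lemma defic_heavy th S A J z : 0 < th -> J \subset ~: S -> J != set0 ->
  th ^+ #|J| * #|A|%:R < #|slice A J z|%:R ->
  #|slice A J z|%:R * defic (S :|: J) (slice A J z)
  + #|A :\: slice A J z|%:R * defic S (A :\: slice A J z)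
  <= #|A|%:R * defic S A
     - #|slice A J z|%:R * #|J|%:R * (ln #|Sg|%:R + ln th - 1).
Proof.
move=> th0 sJ J0 hv; have e := card_setDr (slice_sub A J z).
rewrite /defic card_setC_union//.
have s1 : 0 < #|slice A J z|%:R :> R.
  by apply: le_lt_trans hv; rewrite mulr_ge0// exprn_ge0// ltW.
have a1 : 0 < #|A|%:R :> R.
  by apply: lt_le_trans s1 _; rewrite ler_nat subset_leq_card ?slice_sub.
have j1 : 1 <= #|J|%:R :> R by rewrite ler1n card_gt0.
have h0 := mul_ln_ratio_le (ler0n _ #|A :\: slice A J z|) a1.
have h1 : #|J|%:R * ln th + ln #|A|%:R <= ln #|slice A J z|%:R.
  rewrite mulr_natl -lnXn// -lnM ?posrE ?exprn_gt0//.
  by rewrite ler_ln ?posrE ?mulr_gt0 ?exprn_gt0// ltW.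
have h2 := ler_wpM2l (ltW s1) h1.
have h3 := ler_wpM2l (ltW s1) j1.
move: e h0 h2 h3; set a := _%:R; set b := #|slice _ _ _|%:R.
set c := #|_ :\: _|%:R; set j := #|J|%:R; set l := ln #|Sg|%:R.
set u := #|~: S|%:R; move=> e h0 h2 h3.
have -> : a * (u * l - ln a) = (b + c) * (u * l - ln a) by rewrite -e.
nra.
Qed.

(** Chain rule: the part of [x] on [J] has entropy at most [#|J| * ln #|Sg|]. Each slice is compared
    with the mean slice size, and the linear error terms cancel in the sum. *)
Lemma defic_reveal S A J : J \subset ~: S ->
  \sum_(z in cells J) #|slice A J z|%:R * defic (S :|: J) (slice A J z)
  <= #|A|%:R * defic S A.
Proof.
move=> sJ; have [->|A0] := eqVneq A set0.
  rewrite cards0 mul0r big1// => z _.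
  have -> : slice set0 J z = set0 by apply/setP => x; rewrite !inE.
  by rewrite cards0 mul0r.
have a1 : 0 < #|A|%:R :> R by rewrite ltr0n card_gt0.
have M0 : 0 < (#|Sg| ^ #|J|)%:R :> R by rewrite ltr0n expn_gt0 Sg_gt0.
have am : 0 < #|A|%:R / (#|Sg| ^ #|J|)%:R :> R by rewrite divr_gt0.
have lm : ln (#|A|%:R / (#|Sg| ^ #|J|)%:R) = ln #|A|%:R - #|J|%:R * ln #|Sg|%:R :> R.
  by rewrite ln_div ?posrE// natrX lnXn ?ltr0n ?Sg_gt0// mulr_natl.
apply: (@le_trans _ _ (\sum_(z in cells J) (#|slice A J z|%:R * defic S A +
   (#|A|%:R / (#|Sg| ^ #|J|)%:R - #|slice A J z|%:R)))).
  apply: ler_sum => z _; rewrite /defic card_setC_union//.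
  have := mul_ln_ratio_le (ler0n _ #|slice A J z|) am; rewrite lm.
  nra.
rewrite big_split /= -mulr_suml -card_set_slices sumrB -card_set_slices.
rewrite sumr_const card_cells -[X in _ + (X - _)]mulr_natr divfK ?gt_eqF//.
by rewrite subrr addr0.
Qed.

Lemma mass_le W A B : mass W A B <= #|A|%:R * #|B|%:R.
Proof.
rewrite mulr_natl -sumr_const; apply: ler_sum => x _.
rewrite -sumr_const; apply: ler_sum => y _.
by case: (W x y); rewrite ?ler01.
Qed.

Lemma mass_setID W A A1 B : A1 \subset A ->
  mass W A B = mass W A1 B + mass W (A :\: A1) B.
Proof. by move=> s; rewrite /mass (big_setID A1) /= (setIidPr s). Qed.

Lemma mass_flip W A B : mass W A B = mass (fun y x => W x y) B A.
Proof. by rewrite /mass exchange_big. Qed.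

Lemma mass_slices W J A B :
  mass W A B = \sum_(z in cells J) mass W A (slice B J z).
Proof.
by rewrite exchange_big /=; apply: eq_bigr => x _; exact: sum_slices.
Qed.

End Inputs.

Lemma card_le_cover (T I : finType) (X : {set T}) (P : pred I) (F : I -> {set T}) :
  (forall y, y \in X -> exists2 b, P b & y \in F b) ->
  (#|X| <= \sum_(b | P b) #|F b|)%N.
Proof.
move=> h; apply: (@leq_trans #|\bigcup_(b | P b) F b|).
  by apply/subset_leq_card/subsetP => y /h[b Pb yF]; apply/bigcupP; exists b.
elim/big_ind2: _ => [|m1 n1 m2 n2 h1 h2|//]; first by rewrite cards0.
by rewrite (leq_trans (leq_card_setU _ _))// leq_add.
Qed.

Lemma setUD_sub (I : finType) (S T : {set I}) : T \subset S -> T :|: (S :\: T) = S.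
Proof. by move=> sT; rewrite setDE setUIr setUCr setIT (setUidPr sT). Qed.

(** * Success probability of deterministic protocols *)

Section Closure.
Variables (R : realType) (k : nat) (Sg : finType) (s0 : Sg).
Local Notation inp := {ffun 'I_k -> Sg}.
Local Notation rel4 := ('I_k -> 'I_k -> Sg -> Sg -> Sg -> Sg -> bool).
Implicit Types (A B X : {set inp}) (S T J : {set 'I_k}) (x y z : inp).
Implicit Types (W : inp -> inp -> bool) (nb : rel4) (C : R).
Variables (K eta kappa th zeta tau : R).

(** Here [nb i j a a' b b'] stands for a non-edge between [(i, (a, b))] and [(j, (a', b'))]; Alice
    holds [a] and [a'], Bob holds [b] and [b']. *)
Definition low_degree nb := forall i j a a' b', i != j ->
  #|[set b | nb i j a a' b b']|%:R <= tau.
Definition flip nb : rel4 := fun i j a a' b b' => nb i j b b' a a'.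
Definition nb_sym nb := forall i j a a' b b', nb i j a a' b b' = nb j i a' a b' b.
Definition nobad nb S A B := forall i j, i \in S -> j \in S -> i != j ->
  forall x y, x \in A -> y \in B -> ~~ nb i j (x i) (x j) (y i) (y j).
(* Bounds the success probability from a state where Alice has fixed S and Bob T.
   [K] is the number of blocks after which the bound becomes trivial, [eta] the price
   of a reveal still owed by Bob, and [kappa] converts deficiency, and [C] bits of
   remaining communication, into success probability. *)
Definition pot S T A B C : R :=
  #|S|%:R / K + eta * (#|S|%:R - #|T|%:R) + kappa * (defic R S A + defic R T B + C) + th.
(** A state is settled before a message and active just after one of Alice: her set need not be
    spread out, and she may be some blocks ahead of Bob. [closure] passes from the first kind of
    bound to the second. *)
Definition settled nb W C := forall S A B, fixed S A -> fixed S B ->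
  clean th S A -> clean th S B -> nobad nb S A B ->
  mass R W A B <= #|A|%:R * #|B|%:R * pot S S A B C.
Definition active nb W C := forall S T A B, T \subset S -> fixed S A -> fixed T B ->
  clean th T B -> nobad nb T A B ->
  mass R W A B <= #|A|%:R * #|B|%:R * pot S T A B C.

Hypotheses (K_gt0 : 0 < K) (th_gt0 : 0 < th) (kappa_ge0 : 0 <= kappa).
Hypotheses (zeta_ge0 : 0 <= zeta) (etaE : eta = K * zeta).
Hypothesis tau_th : tau * th <= zeta.
Hypothesis tau_th2 : #|Sg|%:R * tau * th ^+ 2 <= zeta.
Hypothesis kappaP : K^-1 + eta <= kappa * (ln #|Sg|%:R + ln th - 1).

(** * Chance that a reveal exposes a non-edge *)

Lemma eta_ge0 : 0 <= eta. Proof. by rewrite etaE mulr_ge0// ltW. Qed.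

(** If Bob has fixed block [j], then [y j] is constant and at most [tau] values of [y i] are bad,
    each of frequency at most [th]. Otherwise at most [#|Sg| * tau] pairs of values are bad, each of
    frequency at most [th ^+ 2]. *)
Lemma bad_pair nb T B i j a a' : low_degree nb -> fixed T B -> clean th T B ->
  i \notin T -> i != j ->
  #|[set y in B | nb i j a a' (y i) (y j)]|%:R <= zeta * #|B|%:R.
Proof.
move=> ld fB /cleanP cB iT ij.
have [->|[y0 y0B]] := set_0Vmem B.
  rewrite (_ : [set y in set0 | _] = set0) ?cards0 ?mulr0//.
  by apply/setP => y; rewrite !inE.
have [jT|jT] := boolP (j \in T).
  apply: (@le_trans _ _ (\sum_(b | nb i j a a' b (y0 j)) #|slice B [set i] [ffun=> b]|)%:R).
    rewrite ler_nat; apply: card_le_cover => y; rewrite inE => /andP[yB h].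
    exists (y i); first by rewrite (fB y0 y).
    by rewrite inE yB; apply/agreeP => l; rewrite inE => /eqP ->; rewrite ffunE.
  rewrite natr_sum; apply: (@le_trans _ _ (\sum_(b | nb i j a a' b (y0 j)) (th * #|B|%:R))).
    apply: ler_sum => b _; have := cB [set i] [ffun=> b]; rewrite cards1 expr1; apply.
      by rewrite sub1set inE.
    by rewrite -cards_eq0 cards1.
  rewrite sumr_const -[leLHS]mulr_natl mulrA ler_wpM2r// (le_trans _ tau_th)//.
  rewrite ler_wpM2r ?(ltW th_gt0)//; apply: le_trans (ld i j a a' (y0 j) ij).
  by rewrite ler_nat cardsE.
pose z b b' : inp := [ffun l => if l == i then b else b'].
apply: (@le_trans _ _ (\sum_(p : Sg * Sg | nb i j a a' p.2 p.1)
    #|slice B [set i; j] (z p.2 p.1)|)%:R).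
  rewrite ler_nat; apply: card_le_cover => y; rewrite inE => /andP[yB h].
  exists (y j, y i) => //=.
  rewrite inE yB; apply/agreeP => l; rewrite !inE ffunE.
  by case: eqP => [->//|_ /= /eqP->].
rewrite natr_sum; apply: (@le_trans _ _ (\sum_(p : Sg * Sg | nb i j a a' p.2 p.1) (th ^+ 2 * #|B|%:R))).
  apply: ler_sum => p _; have := cB [set i; j] (z p.2 p.1).
  rewrite cards2 ij; apply.
    by apply/subsetP => l; rewrite !inE => /orP[] /eqP ->.
  by apply/set0Pn; exists i; rewrite !inE eqxx.
rewrite -(pair_big_dep xpredT (fun b' b => nb i j a a' b b') (fun _ _ => th ^+ 2 * #|B|%:R)) /=.
apply: (@le_trans _ _ (\sum_(b' : Sg) tau * (th ^+ 2 * #|B|%:R))).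
  apply: ler_sum => b' _; rewrite sumr_const -[leLHS]mulr_natl ler_wpM2r//.
    by rewrite mulr_ge0// exprn_ge0// ltW.
  by apply: le_trans (ld i j a a' b' ij); rewrite ler_nat cardsE.
by rewrite sumr_const -[leLHS]mulr_natl !mulrA ler_wpM2r// -(mulrA _ th).
Qed.

(** When Alice has fixed [S], one sample [x0] of her set represents all. Only the first block of a
    pair must be newly revealed; the second may be an older one. *)
Definition bad_set nb S T (x0 : inp) B := [set y in B |
  [exists p : 'I_k * 'I_k, [&& p.1 \in S :\: T, p.2 \in S, p.1 != p.2 &
     nb p.1 p.2 (x0 p.1) (x0 p.2) (y p.1) (y p.2)]]].

Lemma bad_set_le nb S T x0 B : low_degree nb -> fixed T B -> clean th T B ->
  #|bad_set nb S T x0 B|%:R <= #|S :\: T|%:R * #|S|%:R * (zeta * #|B|%:R).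
Proof.
move=> ld fB cB.
apply: (@le_trans _ _ (\sum_(p : 'I_k * 'I_k | [&& p.1 \in S :\: T, p.2 \in S & p.1 != p.2])
  #|[set y in B | nb p.1 p.2 (x0 p.1) (x0 p.2) (y p.1) (y p.2)]|)%:R).
  rewrite ler_nat; apply: card_le_cover => y; rewrite inE => /andP[yB /existsP[p]].
  by move=> /and4P[h1 h2 h3 h4]; exists p; [exact/and3P | rewrite inE yB].
rewrite natr_sum; apply: (@le_trans _ _ (\sum_(p : 'I_k * 'I_k |
   [&& p.1 \in S :\: T, p.2 \in S & p.1 != p.2]) (zeta * #|B|%:R))).
  apply: ler_sum => p /and3P[h1 h2 h3]; apply: (bad_pair (T := T)) => //.
  by move: h1; rewrite inE => /andP[].
rewrite sumr_const -[leLHS]mulr_natl ler_wpM2r ?mulr_ge0// -natrM ler_nat -cardsX.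
by apply/subset_leq_card/subsetP => -[p1 p2] /and3P[h1 h2 _]; rewrite in_setX h1.
Qed.

(** Badness depends only on the blocks of [S], where all members of such a slice coincide. *)
Lemma bad_set_slice nb S T x0 B z : T \subset S -> fixed T B ->
  bad_set nb S T x0 B :&: slice B (S :\: T) z != set0 ->
  slice B (S :\: T) z \subset bad_set nb S T x0 B.
Proof.
move=> sT fB /set0Pn[y]; rewrite inE => /andP[yX ys].
have fS : fixed S (slice B (S :\: T) z).
  by have := fixed_slice (J := S :\: T) (z := z) fB; rewrite setUD_sub.
apply/subsetP => y' y's; move: yX; rewrite !inE (subsetP (slice_sub _ _ _) _ y's) /=.
move=> /andP[_ /existsP[p /and4P[h1 h2 h3 h4]]]; apply/existsP; exists p.
have h1' : p.1 \in S by move: h1; rewrite inE => /andP[].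
by rewrite h1 h2 h3 (fS y' y)// (fS y' y).
Qed.

Lemma pot_ge0 S T A B C : T \subset S -> fixed S A -> fixed T B -> 0 <= C ->
  #|S|%:R / K <= pot S T A B C.
Proof.
move=> sT fA fB C0; rewrite /pot -!(addrA (_ / _)) lerDl.
have DA := defic_ge0 R s0 fA; have DB := defic_ge0 R s0 fB.
apply: addr_ge0; last exact: ltW.
apply: addr_ge0; last by apply: mulr_ge0 => //; exact: addr_ge0 (addr_ge0 DA DB) C0.
by rewrite mulr_ge0 ?eta_ge0// subr_ge0 ler_nat subset_leq_card.
Qed.

(** On the slice the potential grows by [#|J| * (K^-1 + eta)] for the new blocks and their future
    reveals; by [kappaP], [kappa] times the drop in [defic_heavy] pays for this. *)
Lemma closure_heavy W C S T A B J z : J \subset ~: S -> J != set0 ->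
  th ^+ #|J| * #|A|%:R < #|slice A J z|%:R ->
  mass R W (slice A J z) B <=
    #|slice A J z|%:R * #|B|%:R * pot (S :|: J) T (slice A J z) B C ->
  mass R W (A :\: slice A J z) B <=
    #|A :\: slice A J z|%:R * #|B|%:R * pot S T (A :\: slice A J z) B C ->
  mass R W A B <= #|A|%:R * #|B|%:R * pot S T A B C.
Proof.
move=> sJ J0 hv h1 h0; rewrite (mass_setID _ _ _ (slice_sub A J z)).
apply: le_trans (lerD h1 h0) _.
have e := card_setDr R (slice_sub A J z).
have H := defic_heavy th_gt0 sJ J0 hv.
have eS : #|S :|: J|%:R = #|S|%:R + #|J|%:R :> R.
  by rewrite -natrD -cardsUI (_ : S :&: J = set0) ?cards0 ?addn0//;
     apply/eqP; rewrite setI_eq0 disjoint_sym disjoints_subset.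
rewrite ![_ * #|B|%:R]mulrC -!mulrA -mulrDr ler_wpM2l// /pot eS.
move: e H; set A1 := slice A J z; set A0 := A :\: A1.
move: (defic R _ A1) (defic R _ A0) (defic R S A) (defic R T B) => D1 D0 D DB.
move: kappaP (#|A|%:R : R) (ler0n R #|A1|) (ler0n R #|J|).
move: (#|A1|%:R : R) (#|A0|%:R : R) (#|J|%:R : R) (#|S|%:R : R) (#|T|%:R : R) (_ + _ - 1).
move=> a1 a0 j s t G kG a a1p jp -> H.
have H1 := ler_wpM2l kappa_ge0 H.
have H2 := ler_wpM2l (mulr_ge0 a1p jp) kG.
rewrite -subr_ge0.
set r := (X in 0 <= X).
have -> : r = kappa * ((a1 + a0) * D - a1 * j * G) - kappa * (a1 * D1 + a0 * D0)
  + (a1 * j * (kappa * G) - a1 * j * (K^-1 + eta)) by rewrite /r; ring.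
by rewrite addr_ge0 ?subr_ge0.
Qed.

(** Non-edges appear on a fraction at most [#|S :\: T| * #|S| * zeta] of Bob's set, which is within
    the debt [eta * (#|S| - #|T|)] because [#|S| <= K]; success there is bounded by 1. Elsewhere the
    hypothesis on [B'] applies with the debt cleared. *)
Lemma closure_reveal nb W C S T A B : 0 <= C -> low_degree nb -> nb_sym nb ->
  #|S|%:R <= K -> T \subset S -> fixed S A -> fixed T B -> clean th T B -> nobad nb T A B ->
  (forall B', B' \subset B -> fixed S B' -> nobad nb S A B' ->
    mass R W A B' <= #|A|%:R * #|B'|%:R * pot S S B' A C) ->
  mass R W A B <= #|A|%:R * #|B|%:R * pot S T A B C.
Proof.
move=> C0 ld sy sK sT fA fB cB nbT ih.
have [A0|[x0 x0A]] := set_0Vmem A.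
  by rewrite A0 cards0 !mul0r /mass big_set0.
pose J := S :\: T; pose X := bad_set nb S T x0 B.
have eTJ : T :|: J = S by rewrite setUD_sub.
have sJ : J \subset ~: T by rewrite /J setDE subsetIr.
have DA := defic_ge0 R s0 fA.
(* One bound for both kinds of cells: [slice X J z] is empty for a good cell and the whole cell for
   a bad one. *)
have cell z : mass R W A (slice B J z) <= #|A|%:R * (#|slice X J z|%:R +
    #|slice B J z|%:R * (#|S|%:R / K + kappa * (defic R S A + C) + th)
    + kappa * (#|slice B J z|%:R * defic R (T :|: J) (slice B J z))).
  have fz : fixed S (slice B J z).
    by rewrite -eTJ; apply: fixed_slice.
  have eX : slice X J z = X :&: slice B J z.
    apply/setP => y; rewrite !inE.
    by case: (y \in B) => //=; rewrite andbC.
  have [X0|X0] := eqVneq (X :&: slice B J z) set0.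
    apply: (le_trans (ih _ (slice_sub _ _ _) fz _)).
      move=> i j iS jS ij x y xA ys; rewrite (fA x x0)// (fA x x0)//.
      have yB := subsetP (slice_sub _ _ _) _ ys.
      have yX : y \notin X.
        apply/negP => yX; have : y \in X :&: slice B J z by rewrite inE yX ys.
        by rewrite X0 inE.
      move: yX; rewrite inE yB /= negb_exists => /forallP yX.
      have [iT|iT] := boolP (i \in T).
        have [jT|jT] := boolP (j \in T); first exact: nbT.
        by have := yX (j, i); rewrite /= inE jT jS iS eq_sym ij /= sy.
      by have := yX (i, j); rewrite /= inE iT jS iS ij.
    rewrite -mulrA ler_wpM2l// /pot eTJ subrr mulr0 addr0 eX X0 cards0 add0r.
    by rewrite le_eqVlt; apply/orP; left; apply/eqP; ring.
  have sX := bad_set_slice sT fB X0.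
  rewrite eX (setIidPr sX); apply: (le_trans (mass_le _ _ _ _)).
  rewrite ler_wpM2l// -addrA lerDl.
  have Dz := defic_ge0 R s0 fz; rewrite eTJ.
  rewrite addr_ge0// ?mulr_ge0//.
  by rewrite addr_ge0 ?(ltW th_gt0)// addr_ge0 ?divr_ge0 ?(ltW K_gt0)// mulr_ge0// addr_ge0.
rewrite (mass_slices R s0 _ J); apply: (le_trans (ler_sum _ (fun z _ => cell z))).
rewrite -mulr_sumr -mulrA ler_wpM2l// !big_split /= -mulr_suml -mulr_sumr.
rewrite -!card_set_slices.
have hX := bad_set_le S x0 ld fB cB.
have hD := ler_wpM2l kappa_ge0 (defic_reveal R s0 B sJ).
have eJ : #|S :\: T|%:R = #|S|%:R - #|T|%:R :> R by rewrite (card_setDr R sT); ring.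
apply: (le_trans (lerD (lerD hX (lexx _)) hD)).
rewrite /pot eJ -subr_ge0; set r := (X in 0 <= X).
have -> : r = (K - #|S|%:R) * (#|S|%:R - #|T|%:R) * zeta * #|B|%:R.
  by rewrite /r etaE; ring.
by rewrite !mulr_ge0// subr_ge0// ler_nat subset_leq_card.
Qed.

Lemma settled_flip nb W C : settled nb W C -> settled (flip nb) (fun y x => W x y) C.
Proof.
move=> h S A B fA fB cA cB nbS; rewrite -mass_flip.
rewrite (_ : #|A|%:R * _ = #|B|%:R * #|A|%:R); last by rewrite mulrC.
have -> : pot S S A B C = pot S S B A C by rewrite /pot [defic _ _ A + _]addrC.
by apply: h => // i j iS jS ij x y xB yA; apply: nbS.
Qed.

(* Alice becomes spread out before Bob reveals anything, so that Bob's distribution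
   is still spread out, jointly on all the blocks of [S :\: T], when he does; then the
   two players exchange roles. *)
Lemma closure nb W C : 0 <= C -> low_degree nb -> low_degree (flip nb) -> nb_sym nb ->
  settled nb W C -> active nb W C.
Proof.
move=> C0 + + + + S T; have [d] := ubnP #|~: T|.
(* The outer induction counts the blocks Bob has not fixed; it decreases at each exchange of
   roles. *)
elim: d => // d IHd in nb W S T * => Td ld ldf sy st A B.
(* Cutting out a heavy slice shrinks [~: S] on the slice and [A] on the remainder, so this sum
   decreases on both. *)
have [e] := ubnP (#|A| + #|~: S|).
elim: e => // e IHe in S A * => Ae sT fA fB cB nbT.
have [KS|SK] := leP K #|S|%:R.
  apply: (le_trans (mass_le _ _ _ _)); rewrite ler_peMr ?mulr_ge0//.
  apply: le_trans (pot_ge0 sT fA fB C0).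
  by rewrite ler_pdivlMr// mul1r.
have [cA|] := boolP (clean th S A); last first.
  rewrite negb_forall => /existsP[J]; rewrite negb_forall => /existsP[z].
  rewrite !negb_imply -ltNge => /and3P[sJ J0 hv].
  have s1 : (0 < #|slice A J z|)%N.
    rewrite -(ltr0n R); apply: le_lt_trans hv.
    by rewrite mulr_ge0// exprn_ge0// ltW.
  have lA := subset_leq_card (slice_sub A J z).
  have lD : (#|A :\: slice A J z| < #|A|)%N.
    by rewrite -(cardsID (slice A J z) A) (setIidPr (slice_sub _ _ _)) -[X in (X < _)%N]add0n ltn_add2r.
  have lS : (#|~: (S :|: J)| < #|~: S|)%N.
    apply: proper_card; rewrite properEneq setCS subsetUl andbT.
    apply: contraNneq J0 => eS; apply/eqP/setP => i; rewrite inE.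
    apply/negP => iJ; have := subsetP sJ _ iJ; rewrite -eS !inE iJ orbT //.
  apply: (closure_heavy sJ J0 hv).
  - apply: IHe => //.
    + by rewrite -ltnS; apply: leq_trans Ae; rewrite !ltnS -addnS leq_add.
    + exact: subset_trans sT (subsetUl _ _).
    + exact: fixed_slice.
    + by move=> i j iT jT ij x y /(subsetP (slice_sub _ _ _)); apply: nbT.
  - apply: IHe => //.
    + by rewrite -ltnS; apply: leq_trans Ae; rewrite !ltnS -addSn leq_add.
    + by apply: fixed_sub fA; apply: subsetDl.
    + by move=> i j iT jT ij x y; rewrite inE => /andP[_]; apply: nbT.
have [eS|nS] := eqVneq S T.
  by subst T; apply: st.
apply: (closure_reveal C0 ld sy (ltW SK)) => // B' sB fB' nbS.
rewrite mass_flip [_%:R * #|B'|%:R]mulrC; apply: (IHd (flip nb)) => //.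
- have : (#|~: S| < #|~: T|)%N.
    by apply: proper_card; rewrite properEneq setCS sT andbT; apply: contra nS => /eqP/setC_inj->.
  by move=> lT; rewrite -ltnS; apply: leq_trans Td; rewrite ltnS.
- by move=> i j a a' b b'; exact: sy.
- exact: settled_flip.
- by move=> i j iS jS ij x y xA yB; apply: nbS.
Qed.

(** * Messages and the protocol tree *)

Lemma pot_mono S T A B C C' : C <= C' -> pot S T A B C <= pot S T A B C'.
Proof. by move=> h; rewrite /pot lerD2r lerD2l ler_wpM2l// lerD2l. Qed.

Lemma active_mono nb W C C' : C <= C' -> active nb W C -> active nb W C'.
Proof.
move=> h aW S T A B sT fA fB cB nbT; apply: le_trans (aW S T A B sT fA fB cB nbT) _.
by rewrite ler_wpM2l ?mulr_ge0// pot_mono.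
Qed.

(** A bit may destroy the spread of Alice's set, so each part starts as an active state with
    [T = S]. The average growth of deficiency, at most 1, is paid by the bit taken from [C]. *)
Lemma settled_bit nb W W1 W0 (f : pred inp) C : active nb W1 C -> active nb W0 C ->
  (forall x y, W x y = if f x then W1 x y else W0 x y) -> settled nb W (C + 1).
Proof.
move=> a1 a0 e S A B fA fB cA cB nbS; pose A1 := [set x in A | f x].
have s1 : A1 \subset A by apply/subsetP => x; rewrite inE => /andP[].
rewrite (mass_setID _ _ _ s1).
have -> : mass R W A1 B = mass R W1 A1 B.
  apply: eq_bigr => x; rewrite inE => /andP[_ fx].
  by apply: eq_bigr => y _; rewrite e fx.
have -> : mass R W (A :\: A1) B = mass R W0 (A :\: A1) B.
  apply: eq_bigr => x; rewrite !inE => /andP[+ xA]; rewrite xA /= => fx.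
  by apply: eq_bigr => y _; rewrite e (negPf fx).
have s0' : A :\: A1 \subset A by exact: subsetDl.
apply: (le_trans (lerD (a1 S S A1 B _ _ _ _ _) (a0 S S (A :\: A1) B _ _ _ _ _))) => //.
- exact: fixed_sub fA.
- by move=> i j iS jS ij x y /(subsetP s1); apply: nbS.
- exact: fixed_sub fA.
- by move=> i j iS jS ij x y /(subsetP s0'); apply: nbS.
have H := ler_wpM2l kappa_ge0 (defic_bit R S s1); have ec := card_setDr R s1.
rewrite ![_ * #|B|%:R]mulrC -!mulrA -mulrDr ler_wpM2l// /pot !subrr !mulr0 !addr0.
move: ec H; move: (defic R S A1) (defic R S (A :\: A1)) (defic R S A) => D1 D0 D.
move: (#|A1|%:R : R) (#|A :\: A1|%:R : R) (#|A|%:R : R) => b c a -> H.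
rewrite -subr_ge0; set r := (X in 0 <= X).
have -> : r = kappa * ((b + c) * D + (b + c)) - kappa * (b * D1 + c * D0).
  by rewrite /r; ring.
by rewrite subr_ge0.
Qed.

(** Predicting a value in a free block succeeds with frequency at most [th]; this is the last
    summand of [pot]. *)
Lemma mass_le_slice W S A B l (c : Sg) : l \notin S -> clean th S A ->
  (forall x y, W x y -> x l = c) -> mass R W A B <= #|A|%:R * #|B|%:R * th.
Proof.
move=> lS /cleanP /(_ [set l] [ffun=> c]); rewrite sub1set inE lS cards1 expr1 => cA h.
have {cA} cA : #|slice A [set l] [ffun=> c]|%:R <= th * #|A|%:R.
  by apply: cA => //; rewrite -cards_eq0 cards1.
have -> : mass R W A B = mass R W (slice A [set l] [ffun=> c]) B.
  rewrite (mass_setID _ _ _ (slice_sub A [set l] [ffun=> c])).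
  rewrite [X in _ + X]big1 ?addr0// => x; rewrite !inE => /andP[+ xA].
  rewrite xA /= => nx; rewrite big1// => y _; case Wxy: (W x y) => //.
  case/negP: nx; apply/agreeP => i; rewrite inE => /eqP ->.
  by rewrite ffunE (h _ _ Wxy).
apply: (le_trans (mass_le _ _ _ _)).
by rewrite [leRHS]mulrC mulrA ler_wpM2r.
Qed.

Lemma mass0 W A B : (forall x y, x \in A -> y \in B -> ~~ W x y) -> mass R W A B = 0.
Proof.
by move=> h; rewrite /mass big1// => x xA; rewrite big1// => y yB; rewrite (negPf (h _ _ xA yB)).
Qed.

(** At a leaf the output names a non-edge: if one of its blocks is free this is a guess, otherwise
    [nobad] makes it wrong. At a node, [closure] makes the bounds for the subtrees active and
    [settled_bit] joins them, with roles exchanged for Bob. *)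
Lemma tree_settled O (win : inp -> inp -> O -> bool) nb (t : proto inp inp O) :
  low_degree nb -> low_degree (flip nb) -> nb_sym nb ->
  (forall o, (forall x y, ~~ win x y o) \/
    exists i j a a' b b', [/\ i != j, nb i j a a' b b' & forall x y, win x y o ->
      [/\ x i = a, x j = a', y i = b & y j = b']]) ->
  settled nb (fun x y => win x y (prun t x y)) (pcost t)%:R.
Proof.
move=> ld ldf sy hwin; elim: t => [o|f t0 IH0 t1 IH1|g t0 IH0 t1 IH1] /=.
- move=> S A B fA fB cA cB nbS.
  have pge : th <= pot S S A B 0%:R.
    rewrite /pot subrr mulr0 !addr0 lerDr addr_ge0 ?divr_ge0 ?(ltW K_gt0)//.
    have DA := defic_ge0 R s0 fA; have DB := defic_ge0 R s0 fB.
    by apply: mulr_ge0 => //; exact: addr_ge0.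
  have ab0 : 0 <= #|A|%:R * #|B|%:R :> R by rewrite mulr_ge0.
  case: (hwin o) => [h|[i [j [a [a' [b [b' [ij nbo h]]]]]]]].
    by rewrite mass0// mulr_ge0// (le_trans _ pge)// ltW.
  have [iS|iS] := boolP (i \in S); last first.
    apply: le_trans (ler_wpM2l ab0 pge).
    by apply: (mass_le_slice (l := i) (c := a) _ iS cA) => x y /h[].
  have [jS|jS] := boolP (j \in S); last first.
    apply: le_trans (ler_wpM2l ab0 pge).
    by apply: (mass_le_slice (l := j) (c := a') _ jS cA) => x y /h[].
  rewrite mass0 ?mulr_ge0//; first by rewrite (le_trans _ pge)// ltW.
  move=> x y xA yB; apply/negP => /h[xi xj yi yj].
  by have := nbS i j iS jS ij x y xA yB; rewrite xi xj yi yj nbo.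
- have a1 := closure (ler0n _ _) ld ldf sy IH1.
  have a0 := closure (ler0n _ _) ld ldf sy IH0.
  rewrite -[_.+1%:R]natr1; apply: (settled_bit (f := f)
    (W1 := fun x y => win x y (prun t1 x y)) (W0 := fun x y => win x y (prun t0 x y))).
  + by apply: active_mono a1; rewrite ler_nat leq_maxr.
  + by apply: active_mono a0; rewrite ler_nat leq_maxl.
  + by move=> x y; case: ifP.
- have syf : nb_sym (flip nb) by move=> i j a a' b b'; exact: sy.
  have a1 := closure (ler0n _ _) ldf ld syf (settled_flip IH1).
  have a0 := closure (ler0n _ _) ldf ld syf (settled_flip IH0).
  rewrite -[_.+1%:R]natr1; apply: (settled_flip (nb := flip nb)
    (W := fun y x => win x y (if g y then prun t1 x y else prun t0 x y))).
  apply: (settled_bit (f := g)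
    (W1 := fun y x => win x y (prun t1 x y)) (W0 := fun y x => win x y (prun t0 x y))).
  + by apply: active_mono a1; rewrite ler_nat leq_maxr.
  + by apply: active_mono a0; rewrite ler_nat leq_maxl.
  + by move=> x y; case: ifP.
Qed.

(** * Uniform inputs and randomized protocols *)

Hypothesis th_ge : #|Sg|%:R^-1 <= th.

Lemma clean_setT : clean th set0 [set: inp].
Proof.
apply/cleanP => J z _ _.
have fS : fixed J (slice [set: inp] J z).
  rewrite -[J in fixed J _]set0U; apply: fixed_slice => x x' _ _ i.
  by rewrite inE.
apply: (@le_trans _ _ (#|Sg| ^ #|~: J|)%:R); first by rewrite ler_nat (fixed_card s0).
have -> : #|[set: inp]| = (#|Sg| ^ #|J| * #|Sg| ^ #|~: J|)%N.
  by rewrite cardsT card_ffun card_ord -expnD cardsC card_ord.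
rewrite natrM !natrX mulrA -exprMn.
have N0 : 0 < #|Sg|%:R :> R by rewrite ltr0n (Sg_gt0 s0).
rewrite ler_peMl ?exprn_ge0//; apply: exprn_ege1.
by rewrite -ler_pdivrMr// div1r.
Qed.

Lemma defic_setT : defic R set0 [set: inp] = 0.
Proof.
rewrite /defic setC0 !cardsT card_ffun card_ord natrX lnXn ?ltr0n ?(Sg_gt0 s0)//.
by rewrite mulr_natl subrr.
Qed.

Lemma proto_mass_le O (win : inp -> inp -> O -> bool) nb (t : proto inp inp O) :
  low_degree nb -> low_degree (flip nb) -> nb_sym nb ->
  (forall o, (forall x y, ~~ win x y o) \/
    exists i j a a' b b', [/\ i != j, nb i j a a' b b' & forall x y, win x y o ->
      [/\ x i = a, x j = a', y i = b & y j = b']]) ->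
  mass R (fun x y => win x y (prun t x y)) setT setT
  <= #|[set: inp]|%:R ^+ 2 * (kappa * (pcost t)%:R + th).
Proof.
move=> ld ldf sy hwin.
have f0 A : fixed set0 A by move=> x x' _ _ i; rewrite inE.
have := closure (ler0n _ _) ld ldf sy (tree_settled t ld ldf sy hwin).
move=> /(_ set0 set0 setT setT (sub0set _) (f0 _) (f0 _) clean_setT) h.
apply: le_trans (h _) _; first by move=> i j; rewrite inE.
by rewrite /pot cards0 !defic_setT subrr mulr0 mul0r !add0r expr2.
Qed.

Lemma rproto_cost_ge O (ok : inp -> inp -> O -> bool) nb (P : rproto R inp inp O) :
  low_degree nb -> low_degree (flip nb) -> nb_sym nb ->
  (forall o, (forall x y, ~~ ok x y o) \/
    exists i j a a' b b', [/\ i != j, nb i j a a' b b' & forall x y, ok x y o ->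
      [/\ x i = a, x j = a', y i = b & y j = b']]) ->
  rsolves ok P -> 2 / 3 <= kappa * (rcost P)%:R + th.
Proof.
move=> ld ldf sy hwin [[P0 P1] hs].
have M0 : 0 < #|[set: inp]|%:R ^+ 2 :> R.
  by rewrite exprn_gt0// ltr0n; apply/card_gt0P; exists [ffun=> s0]; rewrite inE.
have tot : #|[set: inp]|%:R ^+ 2 * (2 / 3) <=
    \sum_(w <- P) w.1 * mass R (fun x y => ok x y (prun w.2 x y)) setT setT.
  rewrite (_ : \sum_(w <- P) _ = \sum_(x in [set: inp]) \sum_(y in [set: inp]) rsucc ok P x y).
    rewrite expr2 -mulrA mulr_natl -sumr_const; apply: ler_sum => x _.
    by rewrite mulr_natl -sumr_const; apply: ler_sum => y _.
  under eq_bigr do rewrite mulr_sumr.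
  rewrite exchange_big; apply: eq_bigr => x _ /=.
  under eq_bigr do rewrite mulr_sumr.
  rewrite exchange_big; apply: eq_bigr => y _ /=.
  rewrite /rsucc [RHS]big_mkcond; apply: eq_bigr => w _.
  by case: ifP; rewrite ?mulr1 ?mulr0.
suff up : \sum_(w <- P) w.1 * mass R (fun x y => ok x y (prun w.2 x y)) setT setT
   <= (\sum_(w <- P) w.1) * (#|[set: inp]|%:R ^+ 2 * (kappa * (rcost P)%:R + th)).
  by rewrite -(ler_pM2l M0) (le_trans tot)// (le_trans up)// P1 mul1r.
move: (leqnn (rcost P)); move: {-1}(rcost P) => c; clear hs P1 tot.
elim: P P0 => [|w P IH] P0; first by rewrite !big_nil mul0r.
rewrite /rcost !big_cons => hc; rewrite mulrDl.
have w0 : 0 <= w.1 by apply: P0; rewrite inE eqxx.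
apply: lerD; last first.
  apply: IH; first by move=> v vP; apply: P0; rewrite inE vP orbT.
  by move: hc; case: ifP => _ hc; [move: hc; rewrite geq_max => /andP[] | exact: hc].
have [w1|w1] := ltP 0 w.1; last first.
  by have -> : w.1 = 0 by [apply/le_anti; rewrite w1 w0]; rewrite !mul0r.
rewrite ler_wpM2l//; apply: (le_trans (proto_mass_le _ ld ldf sy hwin)).
rewrite ler_wpM2l ?exprn_ge0// lerD2r ler_wpM2l// ler_nat.
by move: hc; rewrite w1 geq_max => /andP[].
Qed.

End Closure.

(** * Non-edges of random graphs *)

Section RandomSubset.
Variables (R : realType) (T : finType) (D : {set T}) (p : R).
Hypothesis p01 : 0 <= p <= 1.
Implicit Types (E F : {set T}) (t tau : R).

Lemma sum_powerset_prod (f g : T -> R) :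
  \sum_(E in powerset D) (\prod_(e in E) f e) * (\prod_(e in D :\: E) g e)
  = \prod_(e in D) (f e + g e).
Proof.
rewrite [RHS]big_mkcond /= [RHS](eq_bigr (fun e => (if e \in D then f e else 0) +
   (if e \in D then g e else 1))); last by move=> e _; case: ifP; rewrite ?add0r.
rewrite bigA_distr [LHS]big_mkcond /=; apply: eq_bigr => E _; rewrite powersetE.
have [sE|/subsetPn[e eE eD]] := boolP (E \subset D); last first.
  by rewrite (bigD1 e)//= eE (negPf eD) mul0r.
rewrite [RHS](bigID (mem E)) /=; congr (_ * _).
  by apply: eq_bigr => e eE; rewrite eE (subsetP sE).
rewrite big_mkcond [RHS]big_mkcond; apply: eq_bigr => e _.
by rewrite inE; case: (e \in E).
Qed.

Definition weight E : R := p ^+ #|E| * (1 - p) ^+ #|D :\: E|.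

Lemma weight_ge0 E : 0 <= weight E.
Proof. by case/andP: p01 => p0 p1; rewrite mulr_ge0// exprn_ge0// subr_ge0. Qed.

(** The number of elements of [F] missed by the random set is binomial with parameters [#|F|] and
    [1 - p]; this is its generating function. *)
Lemma weight_mgf F t : F \subset D ->
  \sum_(E in powerset D) weight E * t ^+ #|F :\: E|
  = (p + (1 - p) * t) ^+ #|F|.
Proof.
move=> sF.
transitivity (\prod_(e in D) (p + (1 - p) * (if e \in F then t else 1))).
  rewrite -sum_powerset_prod; apply: eq_bigr => E _.
  rewrite big_split /= !prodr_const mulrA; congr (_ * _).
  rewrite -big_mkcondr /= -prodr_const; apply: eq_bigl => e.
  by rewrite !inE; case: (boolP (e \in F)) => [/(subsetP sF)->|]; rewrite ?andbT ?andbF.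
rewrite (big_setID F) /= (setIidPr sF) [X in _ * X]big1 ?mulr1.
  by rewrite -prodr_const; apply: eq_bigr => e ->.
by move=> e; rewrite inE => /andP[/negPf-> _]; rewrite mulr1 addrC subrK.
Qed.

Lemma weight_sum1 : \sum_(E in powerset D) weight E = 1.
Proof.
have := weight_mgf 1 (sub0set D); rewrite cards0 expr0 => <-.
by apply: eq_bigr => E _; rewrite expr1n mulr1.
Qed.

Lemma expR_half_le2 : expR (1 / 2) <= 2 :> R.
Proof.
have := expR_ge1Dx (- (1 / 2) : R); rewrite expRN => h.
by rewrite -[leRHS]invrK -[leLHS]invrK lef_pV2 ?posrE ?invr_gt0 ?expR_gt0//; lra.
Qed.

(** Markov's inequality for [2 ^+ #|F :\: E|], with [expR (1 / 2) <= 2] and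
    [1 + (1 - p) <= expR (1 - p)]. *)
Lemma weight_tail F tau : F \subset D ->
  \sum_(E in powerset D | tau < #|F :\: E|%:R) weight E
  <= expR ((1 - p) * #|F|%:R - tau / 2).
Proof.
move=> sF; case/andP: p01 => p0 p1.
apply: (@le_trans _ _ ((\sum_(E in powerset D) weight E * 2 ^+ #|F :\: E|) * expR (- (tau / 2)))).
  rewrite big_mkcondr mulr_suml; apply: ler_sum => E _ /=.
  have w0 := weight_ge0 E.
  case: ifP => h; last by rewrite mulr_ge0 ?expR_ge0// mulr_ge0 ?exprn_ge0.
  rewrite -mulrA ler_peMr// expRN ler_pdivlMr ?expR_gt0// mul1r.
  apply: (@le_trans _ _ (expR (1 / 2) ^+ #|F :\: E|)).
    by rewrite -expRM_natl ler_expR; lra.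
  by apply: lerXn2r; rewrite ?nnegrE ?expR_ge0// expR_half_le2.
rewrite weight_mgf// expRD ler_wpM2r ?expR_ge0// [_ * #|F|%:R]mulrC expRM_natl.
apply: lerXn2r; rewrite ?nnegrE ?expR_ge0//; first by lra.
by apply: le_trans (expR_ge1Dx _); lra.
Qed.

Lemma weight_union_bound (I : finType) (F : I -> {set T}) tau delta
    (A : {set T} -> Prop) :
  (forall c, F c \subset D) ->
  (forall c, expR ((1 - p) * #|F c|%:R - tau / 2) <= delta) ->
  (forall E, (forall c, #|F c :\: E|%:R <= tau) -> A E) ->
  1 - #|I|%:R * delta <= \sum_(E in powerset D) (if `[< A E >] then weight E else 0).
Proof.
move=> sF tl gA; rewrite lerBlDr -[leLHS]weight_sum1.
apply: (@le_trans _ _ (\sum_(E in powerset D) ((if `[< A E >] then weight E else 0) +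
   \sum_(c : I) if tau < #|F c :\: E|%:R then weight E else 0))).
  apply: ler_sum => E _; have w0 := weight_ge0 E.
  have [|nA] := boolP `[< A E >].
    by rewrite lerDl sumr_ge0// => c _; case: ifP.
  rewrite add0r; have [c hc] : exists c, tau < #|F c :\: E|%:R.
    apply/not_existsP => h; move/asboolP: nA; apply; apply: gA => c.
    by rewrite leNgt; apply/negP/h.
  by rewrite (bigD1 c)//= hc lerDl sumr_ge0// => c' _; case: ifP.
rewrite big_split /= lerD2l exchange_big /= mulr_natl -sumr_const.
apply: ler_sum => c _; rewrite -big_mkcondr.
exact: le_trans (weight_tail tau (sF c)) (tl c).
Qed.

End RandomSubset.

(** * Stars of a vertex and their missing edges *)

Section GoodGraph.
Variables (R : realType) (m k : nat).
Local Notation vtx := (Vtx m k).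

Definition nonadj (E : {set {set vtx}}) (i j : 'I_k) (a a' b b' : Sigma m) :=
  ~~ adj E (i, (a, b)) (j, (a', b')).

Definition line_vtx (o : bool) (i : 'I_k) (a b : Sigma m) : vtx :=
  (i, if o then (a, b) else (b, a)).

(** The flag [o] tells whose half [a] is: Alice's if true, Bob's if false. A vertex [v] inside block
    [i] gets the empty set, so every index yields a subset of [cross_pairs]. *)
Definition star (c : bool * 'I_k * Sigma m * vtx) : {set {set vtx}} :=
  let: (o, i, a, v) := c in
  if i == v.1 then set0 else [set [set line_vtx o i a b; v] | b : Sigma m].

Lemma star_cross c : star c \subset cross_pairs m k.
Proof.
case: c => [[[o i] a] v] /=; case: eqP => [_|/eqP iv]; first exact: sub0set.
apply/subsetP => _ /imsetP[b _ ->]; rewrite inE.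
by apply/existsP; exists (line_vtx o i a b); apply/existsP; exists v; rewrite iv /=.
Qed.

Lemma card_Sigma : #|{: Sigma m}| = (2 ^ m)%N.
Proof. by rewrite card_tuple card_bool. Qed.

Lemma card_star c : (#|star c| <= 2 ^ m)%N.
Proof.
case: c => [[[o i] a] v] /=; case: eqP => _; first by rewrite cards0.
by rewrite (leq_trans (leq_imset_card _ _))// card_Sigma.
Qed.

Lemma card_star_index :
  #|{: bool * 'I_k * Sigma m * vtx}| = (2 * k ^ 2 * (2 ^ m) ^ 3)%N.
Proof. by rewrite !card_prod card_bool card_ord card_Sigma; ring. Qed.

Lemma line_inj o i j a v : i != j -> v.1 = j ->
  injective (fun b => [set line_vtx o i a b; v]).
Proof.
move=> ij vj b b' /setP /(_ (line_vtx o i a b)); rewrite !inE eqxx /=.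
have -> : (line_vtx o i a b == v) = false.
  by apply/negbTE; apply: contra ij => /eqP e; rewrite -vj -e.
by rewrite orbF /line_vtx => /esym/eqP[]; case: o => -[].
Qed.

Lemma star_low_degree (tau : R) E : (forall c, #|star c :\: E|%:R <= tau) ->
  low_degree tau (nonadj E) /\ low_degree tau (flip (nonadj E)).
Proof.
move=> h.
have H o i j a v : i != j -> v.1 = j ->
    #|[set b | [set line_vtx o i a b; v] \notin E]|%:R <= tau.
  move=> ij vj; apply: le_trans (h (o, i, a, v)); rewrite ler_nat /= vj (negPf ij).
  rewrite -(card_imset _ (line_inj (o := o) (a := a) ij vj)).
  apply/subset_leq_card/subsetP => _ /imsetP[b bE ->]; rewrite inE in bE.
  by rewrite in_setD bE /=; apply/imsetP; exists b.
split=> i j a a' b' ij.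
  exact: (H true i j a (j, (a', b')) ij).
exact: (H false i j a (j, (b', a')) ij).
Qed.

Lemma nonadj_sym E : nb_sym (nonadj E).
Proof. by move=> i j a a' b b'; rewrite /nonadj /adj setUC. Qed.

End GoodGraph.

Lemma S_ok_nonadj (m k : nat) (E : {set {set Vtx m k}}) (o : Vtx m k * Vtx m k) :
  (forall x y, ~~ S_ok E x y o) \/
  exists i j a a' b b', [/\ i != j, nonadj E i j a a' b b' &
    forall x y, S_ok E x y o -> [/\ x i = a, x j = a', y i = b & y j = b']].
Proof.
case: o => -[i [a b]] [j [a' b']].
have okP x y : S_ok E x y ((i, (a, b)), (j, (a', b'))) ->
    [/\ i != j, nonadj E i j a a' b b' & [/\ x i = a, x j = a', y i = b & y j = b']].
  move=> /existsP[i1 /existsP[j1 /and3P[ij /eqP[-> -> -> -> -> ->] nE]]].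
  by split.
have [h|/negP h] := boolP ((i != j) && nonadj E i j a a' b b').
  right; exists i, j, a, a', b, b'; case/andP: h => h1 h2; split=> // x y.
  by case/okP.
by left=> x y; apply/negP => /okP[h1 h2 _]; apply: h; rewrite h1 h2.
Qed.

Lemma ln2_ge_half (R : realType) : 1 / 2 <= ln 2 :> R.
Proof.
rewrite -ler_expR lnK ?posrE//; exact: expR_half_le2.
Qed.

(** * Choice of the parameters *)

Section Constants.
Variables (R : realType) (m k : nat) (p : R).
Hypothesis p01 : 0 <= p <= 1.
Hypothesis m_ge : (80 <= m)%N.

Let N : R := (2 ^ m)%:R.
Let n : R := (2 ^ (2 * m))%:R.
Let ell : R := ln (k%:R * n).
(** A star misses at most [(1 - p) * N] edges on average; the factor 8 brings the tail below
    [expR (- ell) ^+ 4], enough for a union bound over all stars. *)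
Let tau : R := 8 * ((1 - p) * N + ell).
Let theta : R := N `^ (- (19 / 20)).
Let zeta : R := N * tau * theta ^+ 2.

Lemma N_gt0 : 0 < N. Proof. by rewrite ltr0n expn_gt0. Qed.
Lemma nE : n = N ^+ 2. Proof. by rewrite /n /N mulnC expnM natrX. Qed.

(** The constant 40 ensures [ln N / 20 - 1 >= 1], so [kappaP] holds with [kappa = K^-1 + eta]. *)
Lemma lnN_ge : 40 <= ln N.
Proof.
rewrite /N natrX lnXn// -mulr_natl; have := ln2_ge_half R.
have : 80 <= m%:R :> R by rewrite ler_nat.
nra.
Qed.

Lemma theta_gt0 : 0 < theta. Proof. by rewrite powR_gt0 ?N_gt0. Qed.
Lemma ln_theta : ln theta = - (19 / 20) * ln N. Proof. exact: ln_powR. Qed.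

Lemma theta_le : theta <= 1 / 6.
Proof.
have -> : theta = (expR (- ln theta))^-1 by rewrite expRN invrK lnK ?posrE ?theta_gt0.
have h := expR_ge1Dx (- ln theta); rewrite ln_theta in h *.
have := lnN_ge => L; rewrite -[leRHS]invrK lef_pV2 ?posrE ?expR_gt0//; last by lra.
lra.
Qed.

Lemma N_theta_ge1 : 1 <= N * theta.
Proof.
rewrite -ler_ln ?posrE// ?mulr_gt0 ?theta_gt0 ?N_gt0//.
rewrite ln1 lnM ?posrE ?theta_gt0 ?N_gt0// ln_theta; have := lnN_ge; lra.
Qed.

Lemma ell_ge1 : (0 < k)%N -> 1 <= ell.
Proof.
move=> k0; have n0 : 0 < n by rewrite nE exprn_gt0// N_gt0.
have h : ln n <= ell.
  have kn : n <= k%:R * n by rewrite ler_peMl ?ler1n// ltW.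
  by rewrite ler_ln ?posrE// (lt_le_trans n0).
apply: le_trans h; rewrite nE lnXn ?N_gt0// -mulr_natl; have := lnN_ge; lra.
Qed.

(** With [u] and [h] the two powers of [n], [zeta] equals [8 * (u * (1 - p) + ell / h ^+ 2)]. Each
    term of the minimum controls one summand, the second by [ell >= 1]. *)
Lemma lbound_sq_le : (0 < k)%N -> 0 <= lbound m k p /\ lbound m k p ^+ 2 * zeta <= 16.
Proof.
move=> k0; have l1 := ell_ge1 k0; have N0 := N_gt0; have [p0 p1] := andP p01.
rewrite /lbound -/n -/ell; set u := n `^ (1 / 20); set h := n `^ (9 / 40).
have n0 : 0 < n by rewrite nE exprn_gt0.
have u0 : 0 < u by rewrite powR_gt0.
have h0 : 0 < h by rewrite powR_gt0.
have nN r : n `^ r = N `^ (2 * r) by rewrite nE -powR_mulrn ?(ltW N0)// powRrM.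
have sN a b : N `^ a * N `^ b = N `^ (a + b) by rewrite powRD// (gt_eqF N0) implybT.
have eu : N ^+ 2 * theta ^+ 2 = u.
  rewrite /u nN -powR_mulrn ?(ltW N0)// /theta expr2 !sN; congr (_ `^ _); lra.
have eh : h ^+ 2 * (N * theta ^+ 2) = 1.
  rewrite /h nN /theta !expr2 -{3}[N]powRr1 ?(ltW N0)// !sN.
  by rewrite -[RHS](powRr0 N); congr (_ `^ _); lra.
have zE : zeta = 8 * (u * (1 - p) + ell * (N * theta ^+ 2)).
  by rewrite -eu /zeta /tau; ring.
have B0 : 0 <= h / ell by rewrite divr_ge0 ?(ltW h0)//; lra.
have sqB b : 0 <= b -> b <= h / ell -> b ^+ 2 * (ell * (N * theta ^+ 2)) <= 1.
  move=> b0 bB; have e0 : 0 < ell by lra.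
  have : b ^+ 2 <= (h / ell) ^+ 2 by apply: lerXn2r.
  have w0 : 0 <= ell * (N * theta ^+ 2).
    by rewrite mulr_ge0 ?(ltW e0)// mulr_ge0 ?(ltW N0)// exprn_ge0// ltW// theta_gt0.
  move=> /(ler_wpM2r w0) /le_trans; apply.
  have -> : (h / ell) ^+ 2 * (ell * (N * theta ^+ 2)) = h ^+ 2 * (N * theta ^+ 2) / ell.
    by field; rewrite gt_eqF.
  by rewrite eh div1r invf_le1.
case: ltP => p1'.
  have q0 : 0 < u * (1 - p) by rewrite mulr_gt0// subr_gt0.
  set b := Num.min _ _.
  have b0 : 0 <= b by rewrite le_min B0 andbT divr_ge0// sqrtr_ge0.
  have b1 : b ^+ 2 * (u * (1 - p)) <= 1.
    have : b ^+ 2 <= (1 / Num.sqrt (u * (1 - p))) ^+ 2.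
      apply: lerXn2r; rewrite ?nnegrE ?divr_ge0 ?sqrtr_ge0//.
      by rewrite /b ge_min lexx.
    rewrite expr_div_n sqr_sqrtr ?(ltW q0)// expr1n ler_pdivlMr//.
  have bB : b <= h / ell by rewrite /b ge_min lexx orbT.
  have b2 := sqB b b0 bB; split=> //.
  by rewrite zE; lra.
split=> //; have := sqB _ B0 (lexx _); rewrite zE.
have -> : p = 1 by apply/le_anti; rewrite p1' p1.
by rewrite subrr mulr0 add0r; lra.
Qed.

Lemma cost_lower_bound (E : {set {set Vtx m k}}) (P : rproto R (Inp m k) (Inp m k) (Vtx m k * Vtx m k)) :
  (forall c, #|star c :\: E|%:R <= tau) -> rsolves (S_ok E) P ->
  1 / 16 * lbound m k p <= (rcost P)%:R.
Proof.
move=> good sol; have [k0|k0] := posnP k.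
  (* For [k = 0] the conventions [ln 0 = 0] and [0^-1 = 0] make the bound nonpositive. *)
  apply: (@le_trans _ _ 0) => //; rewrite mulr_ge0_le0 ?divr_ge0//.
  rewrite /lbound k0 mul0r ln0// invr0 mulr0; case: ifP => // _.
  by rewrite ge_min lexx orbT.
have [lb0 lbz] := lbound_sq_le k0.
have l1 := ell_ge1 k0; have N0 := N_gt0; have th0 := theta_gt0.
have [p0 p1] := andP p01.
have tau0 : 0 < tau.
  by rewrite /tau mulr_gt0// ltr_wpDl ?mulr_ge0 ?subr_ge0 ?(ltW N0)//; lra.
have zeta0 : 0 < zeta by apply: mulr_gt0; [exact: mulr_gt0 | exact: exprn_gt0].
have [ld ldf] := star_low_degree good.
have cS : #|{: Sigma m}|%:R = N by rewrite card_Sigma.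
have L := lnN_ge; have Nth := N_theta_ge1.
have main K : 0 < K -> 2 / 3 <= (K^-1 + K * zeta) * (rcost P)%:R + theta.
  move=> K0; have eta0 : 0 <= K * zeta by rewrite mulr_ge0 ?ltW.
  have kap0 : 0 <= K^-1 + K * zeta by rewrite addr_ge0// invr_ge0 ltW.
  have t1 : tau * theta <= zeta.
    rewrite -[leLHS]mul1r (_ : zeta = N * theta * (tau * theta)); last first.
      by rewrite /zeta; ring.
    by rewrite ler_wpM2r// mulr_ge0 ?ltW.
  have t2 : #|{: Sigma m}|%:R * tau * theta ^+ 2 <= zeta by rewrite cS.
  have t3 : K^-1 + K * zeta <=
      (K^-1 + K * zeta) * (ln #|{: Sigma m}|%:R + ln theta - 1).
    by rewrite cS ler_peMr// ln_theta; lra.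
  have t4 : #|{: Sigma m}|%:R^-1 <= theta.
    by rewrite cS -[leLHS]mul1r ler_pdivrMr// mulrC.
  exact: (rproto_cost_ge [tuple of nseq m false] K0 th0 kap0 (ltW zeta0) (erefl _)
    t1 t2 t3 t4 ld ldf (@nonadj_sym m k E) (@S_ok_nonadj m k E) sol).
have th6 := theta_le.
have [c0|c0] := posnP (rcost P).
  by have := main 1 ltr01; rewrite c0; lra.
have C0 : 0 < (rcost P)%:R :> R by rewrite ltr0n.
(* The choice [K = 4 * C] leaves [2 / 3 <= 1 / 4 + 4 * (C ^+ 2 * zeta) + 1 / 6], hence
   [C ^+ 2 * zeta >= 1 / 16]. *)
have := main (4 * (rcost P)%:R) (mulr_gt0 (ltr0n _ 4) C0).
move: C0; set C := (rcost P)%:R => C0.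
have -> : ((4 * C)^-1 + 4 * C * zeta) * C = 1 / 4 + 4 * (C ^+ 2 * zeta).
  by field; rewrite gt_eqF.
move=> h; have {}h : 16 <= 16 ^+ 2 * (C ^+ 2 * zeta) by lra.
have : lbound m k p ^+ 2 * zeta <= (16 * C) ^+ 2 * zeta.
  by apply: le_trans lbz _; rewrite [in leRHS]exprMn -[leRHS]mulrA.
rewrite ler_pM2r// ler_pXn2r ?nnegrE ?mulr_ge0 ?(ltW C0)//; lra.
Qed.

(** There are [2 * k ^ 2 * N ^ 3] stars, each failing with probability at most [(k * n) ^ -4]. *)
Lemma good_graph_prob (A : {set {set Vtx m k}} -> Prop) :
  (forall E, (forall c, #|star c :\: E|%:R <= tau) -> A E) ->
  1 - 2 / n <= gnpk_prob m k p A.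
Proof.
move=> gA; have [p0 p1] := andP p01; have N0 := N_gt0.
have n0 : 0 < n by rewrite nE exprn_gt0.
have tl (c : bool * 'I_k * Sigma m * Vtx m k) :
    expR ((1 - p) * #|star c|%:R - tau / 2) <= expR (- ell) ^+ 4.
  rewrite -expRM_natl ler_expR.
  have : #|star c|%:R <= N by rewrite /N ler_nat card_star.
  have q0 : 0 <= 1 - p by rewrite subr_ge0.
  move=> /(ler_wpM2l q0); have : 0 <= (1 - p) * N by rewrite mulr_ge0// ltW.
  rewrite /tau; lra.
apply: le_trans (weight_union_bound p01 (@star_cross m k) tl gA).
rewrite lerD2l lerN2 card_star_index.
have [k0|k0] := posnP k.
  by rewrite k0 muln0 mul0n mul0r divr_ge0// ltW.
have k1 : 1 <= k%:R :> R by rewrite ler1n.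
have kn0 : 0 < k%:R * n by rewrite mulr_gt0// (lt_le_trans _ k1).
rewrite expRN lnK ?posrE// !natrM !natrX -/(2%:R ^+ m).
rewrite -natrX -/N exprVn ler_pdivrMr ?exprn_gt0//.
have N1 : 1 <= N by rewrite /N ler1n expn_gt0.
have -> : 2 / n * (k%:R * n) ^+ 4 = 2 * k%:R ^+ 2 * N ^+ 3 * (k%:R ^+ 2 * N ^+ 3).
  by rewrite nE; field; rewrite gt_eqF.
rewrite ler_peMr//; first by rewrite !mulr_ge0// ?exprn_ge0// ltW.
by rewrite mulr_ege1// exprn_ege1.
Qed.

End Constants.

(* n = 2^(2m); asymptotically almost surely, uniformly in k and p. *)
Theorem theorem6p1 (R : realType) :
  exists c : R, 0 < c /\
  forall eps : R, 0 < eps ->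
  exists N : nat, forall (m k : nat) (p : R),
    (N <= m)%N -> 0 <= p <= 1 ->
    1 - eps <=
      gnpk_prob m k p
        (fun E => forall P : rproto R (Inp m k) (Inp m k) (Vtx m k * Vtx m k),
           rsolves (S_ok E) P -> c * lbound m k p <= (rcost P)%:R).
Proof.
exists (1 / 16); split=> [|eps eps0]; first by rewrite divr_gt0.
(* The second term gives [2 / eps <= m <= n], hence [2 / n <= eps]. *)
exists (maxn 80 (Num.bound (2 / eps))) => m k p; rewrite geq_max => /andP[m80 mb] p01.
have good E h P := @cost_lower_bound R m k p p01 m80 E P h.
apply: le_trans (good_graph_prob p01 good).
rewrite lerD2l lerN2 ler_pdivrMr ?ltr0n ?expn_gt0// mulrC -ler_pdivrMr//.
have e0 : 0 <= 2 / eps by rewrite divr_ge0// ltW.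
apply: le_trans (ltW (archi_boundP e0)) _.
rewrite ler_nat (leq_trans mb)// (leq_trans (ltnW (ltn_expl m (ltnSn 1))))//.
by rewrite leq_exp2l// leq_pmull.
Qed.
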